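(* Let $n$ be a positive integer with $n\leq 4$. Then \[ \gamma(H_{1,n}) =\begin{cases} 3 & \text{if } n = 1,\\ 5 & \text{if } n = 2,\\ 7 & \text{if } n = 3,\\ 9 & \text{if } n = 4. \end{cases}\]
   Context: The infinite truncated square tiling graph $H_{\infty,\infty}$ has vertex set $\{(a,(x,y)) : a\in\mathbb{Z}_4,\ (x,y)\in\mathbb{Z}^2\}$. Its edges are: $(a,(x,y))\sim(a+1,(x,y))$ with $a+1$ taken modulo 4 (so each $(x,y)$ carries a 4-cycle whose vertices $0,1,2,3$ are its top, right, bottom, left vertices); $(1,(x,y))\sim(3,(x+1,y))$; and $(0,(x,y))\sim(2,(x,y+1))$. For $(x,y)\in\mathbb{Z}^2$ the octagon $O_{x,y}$ is the 8-cycle through $(0,(x,y)),(1,(x,y)),(3,(x+1,y)),(0,(x+1,y)),(2,(x+1,y+1)),(3,(x+1,y+1)),(1,(x,y+1)),(2,(x,y+1))$, in this cyclic order. For positive integers $m,n$, $H_{m,n}$ is the finite subgraph consisting of $m$ rows of $n$ octagons each: the union of the octagons $O_{x,y}$ with $0\le x\le n-1$, $0\le y\le m-1$. $\gamma(G)$ denotes the domination number of a finite graph $G$: the smallest cardinality of a set $T$ of vertices such that every vertex of $G$ is in $T$ or adjacent to a vertex of $T$. *)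

(* Defs.v *)
From HB Require Import structures.
From mathcomp Require Import all_boot all_order all_algebra.

Set Implicit Arguments.
Unset Strict Implicit.
Unset Printing Implicit Defensive.

Import GRing.Theory.
Local Open Scope ring_scope.

Section Domination.
Variables (T : finType) (adj : rel T).

Definition dominating (D : {set T}) : bool :=
  [forall v, (v \in D) || [exists u in D, adj u v]].

Lemma dominating_setT : dominating setT.
Proof. by apply/forallP => v; rewrite inE. Qed.

(* The starting point [setT] is dominating ([dominating_setT]), so this is the
   minimum over a nonempty family. *)
Definition domination_number : nat :=
  #|[arg min_(D < [set: T] | dominating D) #|D|]|.

End Domination.

(* (a, (x, y)): the vertex a of the 4-cycle at (x, y), where 0, 1, 2, 3 are
   top, right, bottom, left. *)
Definition vertex : Type := ('Z_4 * (int * int))%type.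

Definition Hinf_arc (u v : vertex) : bool :=
  let: (a, (x, y)) := u in
  [|| v == (a + 1, (x, y)),
      (a == 1) && (v == (3, (x + 1, y))) |
      (a == 0) && (v == (2, (x, y + 1)))].

Definition Hinf_adj (u v : vertex) : bool := Hinf_arc u v || Hinf_arc v u.

Definition octagon (x y : int) : seq vertex :=
  [:: (0, (x, y)); (1, (x, y)); (3, (x + 1, y)); (0, (x + 1, y));
      (2, (x + 1, y + 1)); (3, (x + 1, y + 1)); (1, (x, y + 1));
      (2, (x, y + 1))].

Definition cycle_adj (c : seq vertex) (u v : vertex) : bool :=
  [&& u \in c, v \in c & (next c u == v) || (next c v == u)].

Definition H_octagons (m n : nat) : seq (seq vertex) :=
  [seq octagon x%:Z y%:Z | y <- iota 0 m, x <- iota 0 n].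

(* The list of vertices has repetitions, but [seq_sub] identifies them. *)
Definition H_vertex (m n : nat) : finType := seq_sub (flatten (H_octagons m n)).

(* A union of subgraphs: an edge of H_{m,n} is an edge of one of its octagons. *)
Definition H_adj (m n : nat) (u v : H_vertex m n) : bool :=
  has (fun c => cycle_adj c (val u) (val v)) (H_octagons m n).

(* [next] in [cycle_adj] only looks at first occurrences, so [cycle_adj c] is
   the edge relation of the cycle c because c has no repetition. *)
Lemma octagon_uniq (x y : int) : uniq (octagon x y).
Proof.
have nx (z : int) : (z + 1 == z) = false by rewrite -subr_eq0 addrAC subrr.
have nx' (z : int) : (z == z + 1) = false by rewrite eq_sym nx.
by rewrite /= !inE /eq_op /= /eq_op /= ?nx ?nx' ?andbF.
Qed.

Lemma octagon_cycle (x y : int) : cycle Hinf_adj (octagon x y).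
Proof. by rewrite /= /Hinf_adj /= !xpair_eqE !eqxx ?orbT. Qed.

Lemma H_adj_sym (m n : nat) : symmetric (@H_adj m n).
Proof.
by move=> u v; apply: eq_has => c; rewrite /cycle_adj andbCA orbC.
Qed.

Lemma H_adj_Hinf (m n : nat) (u v : H_vertex m n) :
  H_adj u v -> Hinf_adj (val u) (val v).
Proof.
case/hasP=> c /allpairsP[[y x] [_ _ ->]] /and3P[uc vc].
have nxt w := next_cycle (octagon_cycle x%:Z y%:Z) (x := w).
case/orP=> /eqP <-; first exact: nxt.
by rewrite /Hinf_adj orbC; exact: nxt.
Qed.

(* Main.v *)
Require Import Defs.
From mathcomp Require Import all_boot all_order all_algebra.
From mathcomp Require Import zify.

(** The row of [n] octagons is a ladder: a lower and an upper path with
    [3 n + 1] vertices each, joined by a rung at every third vertex; the rung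
    [x] is the edge from [(0, (x, 0))] to [(2, (x, 1))].  The domination
    number is [2 n + 1], by linear programming duality.

    For the lower bound, give weight [1] to the ends of the rungs; on the
    horizontal edge from rung [x] to rung [x + 1], in either path, give weight
    [n - x] to the left end and [x + 1] to the right end.  Every closed
    neighbourhood weighs [n + 2]:
    - an end of the rung [x] sees itself, the other end, and the neighbours
      of weights [x] and [n - x] (at the two ends of the ladder a neighbour is
      missing, but its weight would be [0]);
    - any other vertex sees an end of a rung and both ends of its horizontal
      edge, of total weight [1 + (n - x) + (x + 1)].
    The closed neighbourhoods of the vertices of a dominating set [D] cover the
    graph, of total weight [2 (n + 1) ^ 2 = 2 n (n + 2) + 2], so [D] has more
    than [2 n] elements ([dominating_weight]).

    For the upper bound, take the lower ends of all rungs and, in the upper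
    path, the left ends of the horizontal edges ([zigzag]): the former dominate
    the lower path and all rungs, the latter the horizontal edges of the upper
    path.

    The argument is uniform in [n].  For [n <= 4] the facts that it rests on
    (the weights of the neighbourhoods, the total weight, the domination by
    [zigzag]) are finitely many, and evaluation settles them: [row_vertices] and
    [row_adj] restate the graph on lists of vertices for this purpose. *)

Set Implicit Arguments.
Unset Strict Implicit.
Unset Printing Implicit Defensive.

Section Domination.
Variables (T : finType) (adj : rel T).

Lemma domination_number_le (D : {set T}) :
  dominating adj D -> domination_number adj <= #|D|.
Proof.
move=> domD; rewrite /domination_number.
by case: arg_minnP => [|E _ minE]; [exact: dominating_setT | exact: minE].
Qed.

Lemma domination_number_attained :
  exists2 D : {set T}, dominating adj D & #|D| = domination_number adj.
Proof.
rewrite /domination_number.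
by case: arg_minnP => [|D domD _]; [exact: dominating_setT | exists D].
Qed.

(** Weak duality between dominating sets and fractional packings: the closed
    neighbourhoods of the elements of [D] cover all the weight. *)
Lemma dominating_weight (w : T -> nat) (c : nat) (D : {set T}) :
    dominating adj D ->
    (forall u, \sum_(v | (v == u) || adj u v) w v <= c) ->
  \sum_v w v <= c * #|D|.
Proof.
move=> /forallP domD packed.
have cover v : w v <= \sum_(u in D | (v == u) || adj u v) w v.
  have [u uD uv] : exists2 u, u \in D & (v == u) || adj u v.
    case/orP: (domD v) => [vD | /exists_inP[u uD uv]].
      by exists v; rewrite ?eqxx.
    by exists u; rewrite ?uv ?orbT.
  by rewrite (bigD1 u) ?uD //= leq_addr.
apply: (@leq_trans (\sum_v \sum_(u in D | (v == u) || adj u v) w v)).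
  by apply: leq_sum => v _; exact: cover.
rewrite (exchange_big_dep (mem D)) /=; last by move=> v u _ /andP[].
rewrite mulnC -sum_nat_const; apply: leq_sum => u uD.
by under eq_bigl => v do rewrite (_ : u \in D) //; exact: packed.
Qed.

End Domination.

(** Turns the weight of a set of vertices into an expression that evaluates;
    [undup] is there because neighbouring octagons list their common vertices
    twice. *)
Lemma sum_seq_sub (T : choiceType) (s : seq T) (P : pred T) (F : T -> nat) :
  \sum_(v : seq_sub s | P (val v)) F (val v) =
    sumn [seq F x | x <- undup s & P x].
Proof.
rewrite sumnE big_map big_filter -(big_map val P F).
apply: perm_big; apply: uniq_perm; rewrite ?undup_uniq //.
  by rewrite map_inj_uniq ?index_enum_uniq //; exact: val_inj.
move=> x; rewrite mem_undup; apply/mapP/idP => [[v _ ->] | xs].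
  exact: valP.
by exists (Sub x xs); rewrite ?mem_index_enum ?SubK.
Qed.

Section OctagonRow.
Variable n : nat.

Definition row_vertices : seq vertex := flatten (H_octagons 1 n).

Definition row_adj (u v : vertex) : bool :=
  has (fun c => cycle_adj c u v) (H_octagons 1 n).

(** In either path the vertex [1] at [x] is the left end of the horizontal edge
    from rung [x] to rung [x + 1], whose right end is the vertex [3] at [x + 1],
    of weight [x + 1]; the other vertices of the graph are the ends of the
    rungs.  The formula vanishes on the neighbours that the outermost rungs
    lack. *)
Definition weight (v : vertex) : nat :=
  let: (a, (x, _)) := v in
  if a == 1%R then n - absz x else if a == 3%R then absz x else 1.

Definition zigzag : seq vertex :=
  [seq (0, (x%:Z, 0))%R | x <- iota 0 n.+1] ++
  [seq (1, (x%:Z, 1))%R | x <- iota 0 n].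

Lemma size_zigzag : size zigzag = n.*2.+1.
Proof. by rewrite size_cat !size_map !size_iota -addnn addSn. Qed.

Definition weight_packed : bool :=
  all (fun u => sumn [seq weight v |
                 v <- undup row_vertices & (v == u) || row_adj u v] <= n.+2)
    row_vertices.

Definition total_weight : nat := sumn [seq weight v | v <- undup row_vertices].

Definition zigzag_dominates : bool :=
  all (fun v => (v \in zigzag) || has (row_adj^~ v) zigzag) row_vertices.

Lemma domination_number_row_ge :
    weight_packed -> total_weight = 2 * n.+1 ^ 2 ->
  n.*2 < domination_number (@H_adj 1 n).
Proof.
move=> packed total.
have [D domD <-] := domination_number_attained (@H_adj 1 n).
have packedH u :
    \sum_(v : H_vertex 1 n | (v == u) || H_adj u v) weight (val v) <= n.+2.
  rewrite (sum_seq_sub _ (fun v => (v == val u) || row_adj (val u) v)).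
  exact: (allP packed) _ (valP u).
have := dominating_weight domD packedH.
rewrite (sum_seq_sub _ xpredT) filter_predT -/row_vertices -/total_weight total.
(* The total weight 2 (n + 1)^2 exceeds 2 n (n + 2) by 2. *)
nia.
Qed.

Lemma domination_number_row_le :
    {subset zigzag <= row_vertices} -> zigzag_dominates ->
  domination_number (@H_adj 1 n) <= n.*2.+1.
Proof.
move=> zigzagP dom.
pose D := [set v : H_vertex 1 n | val v \in zigzag].
have domD : dominating (@H_adj 1 n) D.
  apply/forallP=> v; rewrite inE.
  case/orP: (allP dom _ (valP v)) => [-> // | /hasP[u uZ uv]].
  apply/orP; right; apply/exists_inP.
  by exists (Sub u (zigzagP u uZ)); rewrite ?inE.
apply: leq_trans (domination_number_le domD) _.
rewrite -size_zigzag cardE -(size_map val).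
apply: uniq_leq_size.
  by rewrite map_inj_uniq ?enum_uniq //; exact: val_inj.
by move=> x /mapP[v]; rewrite mem_enum inE => vZ ->.
Qed.

End OctagonRow.

Lemma domination_number_row (n : nat) : 0 < n -> n <= 4 ->
  domination_number (@H_adj 1 n) = n.*2.+1.
Proof.
move=> n_gt0 n_le4.
have [packed total sub dom] :
    [/\ weight_packed n, total_weight n == 2 * n.+1 ^ 2,
        all (mem (row_vertices n)) (zigzag n) & zigzag_dominates n].
  by move: n n_gt0 n_le4 => [|[|[|[|[|n]]]]] // _ _; split; vm_compute.
apply/eqP; rewrite eqn_leq domination_number_row_ge ?(eqP total) //.
by rewrite domination_number_row_le //; exact/allP.
Qed.

Theorem theorem2p4 (n : nat) (n_gt0 : 0 < n) (n_le4 : n <= 4) :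
  domination_number (@H_adj 1 n) =
    if n == 1 then 3 else
    if n == 2 then 5 else
    if n == 3 then 7 else 9.
Proof.
by rewrite domination_number_row //; move: n n_gt0 n_le4 => [|[|[|[|[|]]]]].
Qed.
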